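(* Let $\lambda$ be a nonzero complex number and $x$ a complex number. For every integer $n \geq 0$, $$\sum_{m=0}^n C_m(x)\, \lambda^{n-m}\, S_1(n,m) = \sum_{m=0}^n \frac{(n-m)!}{n-m+1}\binom{n}{m}(-1)^{n-m}\lambda^{n-m}\, C_{m,\lambda}(x),$$ where $C_m(x)$ are the Cauchy polynomials, $C_{m,\lambda}(x)$ are the degenerate Cauchy polynomials of the second kind, and $S_1(n,m)$ are the (signed) Stirling numbers of the first kind.
   Context: All generating functions are formal power series in $t$; $\log(1+u)=\sum_{k\ge 1}\frac{(-1)^{k-1}}{k}u^k$ and $(1+u)^x=\sum_{k\ge 0}(x)_k\frac{u^k}{k!}$, where $(x)_0=1$ and $(x)_k=x(x-1)\cdots(x-k+1)$ for $k\geq 1$. The Cauchy polynomials $C_n(x)$ are defined by $$\frac{t}{\log(1+t)}(1+t)^x=\sum_{n=0}^\infty C_n(x)\frac{t^n}{n!}.$$ The degenerate Cauchy polynomials of the second kind $C_{n,\lambda}(x)$ are defined by $$\frac{t}{\log\left(1+\frac{1}{\lambda}\log(1+\lambda t)\right)}\left(1+\tfrac{1}{\lambda}\log(1+\lambda t)\right)^x=\sum_{n=0}^\infty C_{n,\lambda}(x)\frac{t^n}{n!}.$$ The Stirling numbers of the first kind $S_1(n,l)$ are defined by $(x)_n=\sum_{l=0}^n S_1(n,l)x^l$ for $n\ge 0$. *)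

(* Defs.v *)
From mathcomp Require Import all_boot all_order all_algebra.

Set Implicit Arguments.
Unset Strict Implicit.
Unset Printing Implicit Defensive.

Import GRing.Theory.
Local Open Scope ring_scope.

Definition ffactr (R : pzRingType) (x : R) (k : nat) : R :=
  \prod_(i < k) (x - i%:R).

(* The signed Stirling numbers of the first kind S_1(n, l): the coefficients
   of the falling factorial of the indeterminate. *)
Definition stirling1 (n l : nat) : int := (ffactr ('X : {poly int}) n)`_l.

Lemma ffactr_stirling1 (R : comNzRingType) (x : R) (n : nat) :
  ffactr x n = \sum_(l < n.+1) (stirling1 n l)%:~R * x ^+ l.
Proof.
have sz : (size (ffactr ('X : {poly int}) n) <= n.+1)%N.
  rewrite /ffactr (eq_bigr (fun i : 'I_n => 'X - (i%:R)%:P)); last first.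
    by move=> i _; rewrite polyC_natr.
  by rewrite size_prod_XsubC /index_enum -enumT size_enum_ord.
have szm : (size (map_poly (intr : int -> R) (ffactr 'X n)) <= n.+1)%N.
  exact: leq_trans (size_poly _ _) sz.
transitivity (map_poly (intr : int -> R) (ffactr 'X n)).[x].
  rewrite /ffactr rmorph_prod horner_prod; apply: eq_bigr => i _.
  by rewrite rmorphB /= map_polyX rmorph_nat hornerD hornerX hornerN
             -polyC_natr hornerC.
rewrite (horner_coef_wide _ szm); apply: eq_bigr => l _.
by rewrite coef_map.
Qed.

Section FormalPowerSeries.
Variable K : fieldType.

(* A formal power series in t is its sequence of coefficients: [f n] is the
   coefficient of t ^ n. *)
Definition fps : Type := nat -> K.

Implicit Types (f g u : fps) (a : nat -> K) (c x : K).

Definition fps1 : fps := fun n => (n == 0)%:R.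

Definition fpsX : fps := fun n => (n == 1)%:R.

Definition fps_scale c f : fps := fun n => c * f n.

Definition fps_mul f g : fps := fun n => \sum_(i < n.+1) f i * g (n - i)%N.

Definition fps_exp f k : fps := iter k (fps_mul f) fps1.

(* The series \sum_k a_k u ^ k, for u without constant term: u ^ k then has no
   term of degree less than k, so only k <= n contributes to degree n. *)
Definition fps_comp a u : fps :=
  fun n => \sum_(k < n.+1) a k * fps_exp u k n.

(* Multiplicative inverse of f when f 0 != 0: with f = f 0 * (1 - h), it is
   (f 0)^-1 * \sum_k h ^ k. *)
Definition fps_inv f : fps :=
  fps_scale (f 0)^-1
    (fps_comp (fun=> 1) (fun n => if n is 0 then 0 else - (f n / f 0))).

(* The quotient t / f, for f 0 = 0 and f 1 != 0; f itself is not invertible, so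
   t is cancelled first: t / f = (f / t)^-1. *)
Definition fps_X_div f : fps := fps_inv (fun n => f n.+1).

(* log (1 + u), for u 0 = 0 *)
Definition fps_log1p u : fps :=
  fps_comp (fun k => if k is j.+1 then (-1) ^+ j / k%:R else 0) u.

(* (1 + u) ^ x, for u 0 = 0 *)
Definition fps_pow1p u x : fps := fps_comp (fun k => ffactr x k / k`!%:R) u.

Definition cauchy_poly (n : nat) x : K :=
  n`!%:R * fps_mul (fps_X_div (fps_log1p fpsX)) (fps_pow1p fpsX x) n.

(* log (1 + c t) / c *)
Definition degenerate_t c : fps :=
  fps_scale c^-1 (fps_log1p (fps_scale c fpsX)).

(* The degenerate Cauchy polynomials of the second kind C_{n,c}(x), c != 0 *)
Definition degenerate_cauchy2 (n : nat) c x : K :=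
  n`!%:R * fps_mul (fps_X_div (fps_log1p (degenerate_t c)))
                   (fps_pow1p (degenerate_t c) x) n.

Lemma fps_exp_lt u k n : u 0 = 0 -> (n < k)%N -> fps_exp u k n = 0.
Proof.
move=> u0; elim: k n => // k IH n ltnk; rewrite /fps_exp iterS -/(fps_exp u k).
apply: big1 => -[[|i] lti] _ /=; first by rewrite u0 mul0r.
rewrite IH ?mulr0 //; case: n lti ltnk => // n _ ltnk.
by rewrite subSS (leq_ltn_trans (leq_subr _ _)).
Qed.

Lemma fps_invP f : f 0 != 0 -> fps_mul f (fps_inv f) =1 fps1.
Proof.
move=> f0 n; set h : fps := fun n => if n is 0 then 0 else - (f n / f 0).
pose G := fps_comp (fun=> 1) h.
have GE m N : (m <= N)%N -> G m = \sum_(k < N.+1) fps_exp h k m.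
  move=> mN; rewrite /G /fps_comp.
  rewrite (big_ord_widen N.+1 (fun k => 1 * fps_exp h k m)) ?ltnS //.
  rewrite [RHS](bigID (fun k : 'I_N.+1 => (k < m.+1)%N)) /=.
  rewrite [X in _ = _ + X]big1 ?addr0; last first.
    by move=> k; rewrite -leqNgt => /(fps_exp_lt (erefl : h 0 = 0)).
  by apply: eq_bigr => k _; rewrite mul1r.
have hG : fps_mul h G n = \sum_(k < n.+1) fps_exp h k.+1 n.
  rewrite /fps_mul (eq_bigr (fun i : 'I_n.+1 =>
      \sum_(k < n.+1) h i * fps_exp h k (n - i)%N)); last first.
    by move=> i _; rewrite (GE _ n) ?leq_subr // mulr_sumr.
  by rewrite exchange_big.
have fE i : f i / f 0 = fps1 i - h i.
  by case: i => [|i]; rewrite /fps1 /= ?divff ?subr0 // sub0r opprK.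
transitivity (\sum_(i < n.+1) (fps1 i - h i) * G (n - i)%N).
  by apply: eq_bigr => i _; rewrite -fE /fps_inv /fps_scale mulrA.
under eq_bigr do rewrite mulrBl.
rewrite sumrB -/(fps_mul h G n) hG.
rewrite big_ord_recl /= subn0 mul1r big1 ?addr0; last first.
  by move=> i _; rewrite /fps1 /= mul0r.
rewrite (GE n n) // -(big_mkord predT (fun k => fps_exp h k.+1 n)).
rewrite -(big_mkord predT (fun k => fps_exp h k n)) big_nat_recl //.
rewrite [X in _ - X]big_nat_recr //.
by rewrite (@fps_exp_lt h n.+1 n erefl (ltnSn n)) /= addr0 addrK.
Qed.

Lemma fps_X_divP f :
  f 0 = 0 -> f 1 != 0 -> fps_mul f (fps_X_div f) =1 fpsX.
Proof.
move=> f0 f1 [|n]; first by rewrite /fps_mul big_ord1 f0 mul0r.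
rewrite /fps_mul big_ord_recl f0 mul0r add0r.
by rewrite [LHS](@fps_invP (fun n => f n.+1) f1 n) /fps1 /fpsX eqSS.
Qed.

End FormalPowerSeries.

(* Main.v *)
(* Put u = log(1 + c t) / c and F(t) = t / log(1 + t) * (1 + t)^x.  Both sides
   are n! times the coefficient of t^n in F(u).  The left one expands F(u) in
   powers of u, since log(1 + t)^k / k! is the exponential generating function
   of S_1(n, k).  The right one writes
   F(u) = (u / t) * (t / log(1 + u) * (1 + u)^x), where u / t has coefficients
   (- c)^k / (k + 1). *)
Require Import Defs.
From mathcomp Require Import all_boot all_order all_algebra.
From mathcomp Require Import complex reals.
From mathcomp Require Import ring.

Set Implicit Arguments.
Unset Strict Implicit.
Unset Printing Implicit Defensive.

Import GRing.Theory.
Local Open Scope ring_scope.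

Section FormalPowerSeriesTheory.
Variable K : fieldType.
Implicit Types (f g h u : fps K) (c x : K).

(** Only coefficients up to degree [n] enter degree [n] of a product, so the ring laws for series
    are read off from [{poly K}] through truncations. *)
Definition fps_trunc N f : {poly K} := \poly_(i < N) f i.

Lemma coef_fps_trunc N f n : (n < N)%N -> (fps_trunc N f)`_n = f n.
Proof. by move=> ltnN; rewrite coef_poly ltnN. Qed.

Lemma eq_fps_mul f1 f2 g1 g2 :
  f1 =1 f2 -> g1 =1 g2 -> fps_mul f1 g1 =1 fps_mul f2 g2.
Proof. by move=> ef eg n; apply: eq_bigr => i _; rewrite ef eg. Qed.

Lemma coef_fps_mul N f g n : (n < N)%N ->
  fps_mul f g n = (fps_trunc N f * fps_trunc N g)`_n.
Proof.
move=> ltnN; rewrite coefM; apply: eq_bigr => i _.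
rewrite !coef_fps_trunc ?(leq_ltn_trans (leq_subr _ _)) //.
by rewrite (leq_ltn_trans _ ltnN) // -ltnS.
Qed.

Lemma fps_mulC f g : fps_mul f g =1 fps_mul g f.
Proof. by move=> n; rewrite !(@coef_fps_mul n.+1) // mulrC. Qed.

Lemma fps_mulA f g h : fps_mul f (fps_mul g h) =1 fps_mul (fps_mul f g) h.
Proof.
move=> n; pose p := fps_trunc n.+1.
transitivity (p f * p g * p h)`_n.
  rewrite -mulrA coefM; apply: eq_bigr => i _.
  by rewrite coef_fps_trunc ?ltn_ord // -coef_fps_mul // ltnS leq_subr.
rewrite coefM; apply: eq_bigr => i _.
by rewrite coef_fps_trunc ?ltnS ?leq_subr // -coef_fps_mul.
Qed.

Lemma fps_mul1 f : fps_mul f (fps1 K) =1 f.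
Proof.
move=> n; rewrite fps_mulC /fps_mul big_ord_recl /fps1 /= mul1r subn0.
by rewrite big1 ?addr0 // => i _; rewrite mul0r.
Qed.

Lemma fps_mulS f g n : f 0 = 0 ->
  fps_mul f g n.+1 = fps_mul (fun i => f i.+1) g n.
Proof. by move=> f0; rewrite /fps_mul big_ord_recl f0 mul0r add0r. Qed.

Lemma coef_fps_exp N f k n : (n < N)%N ->
  fps_exp f k n = (fps_trunc N f ^+ k)`_n.
Proof.
elim: k n => [|k IH] n ltnN; first by rewrite expr0 coef1.
rewrite /fps_exp iterS -/(fps_exp f k) exprS coefM; apply: eq_bigr => i _.
rewrite -IH ?coef_fps_trunc ?(leq_ltn_trans (leq_subr _ _)) //.
by rewrite (leq_ltn_trans _ ltnN) // -ltnS.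
Qed.

Lemma eq_fps_exp f g k : f =1 g -> fps_exp f k =1 fps_exp g k.
Proof. by move=> efg; elim: k => //= k IH; apply: eq_fps_mul. Qed.

(** The base on the left is a f(b t), and its k-th power is a^k (f^k)(b t). *)
Lemma fps_exp_dilate (a b : K) f k n :
  fps_exp (fun i => a * b ^+ i * f i) k n = a ^+ k * b ^+ n * fps_exp f k n.
Proof.
elim: k n => [|k IH] n.
  by case: n => [|n]; rewrite /fps_exp /fps1 /= ?expr0 ?mulr1 ?mulr0.
rewrite /fps_exp !iterS -!/(fps_exp _ k) /fps_mul mulr_sumr.
apply: eq_bigr => i _; rewrite IH.
have -> : b ^+ n = b ^+ i * b ^+ (n - i) by rewrite -exprD subnKC // -ltnS.
by rewrite exprS; ring.
Qed.

Lemma fps_exp_X k n : fps_exp (fpsX K) k n = (n == k)%:R.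
Proof.
rewrite (@coef_fps_exp n.+2) //.
have -> : fps_trunc n.+2 (fpsX K) = 'X.
  by apply/polyP => -[|[|i]]; rewrite coef_poly coefX //= if_same.
by rewrite coefXn.
Qed.

Lemma eq_fps_comp (f g u v : fps K) :
  f =1 g -> u =1 v -> fps_comp f u =1 fps_comp g v.
Proof.
by move=> ef eu n; apply: eq_bigr => k _; rewrite ef (eq_fps_exp _ eu).
Qed.

Lemma fps_comp_X f : fps_comp f (fpsX K) =1 f.
Proof.
move=> n; rewrite /fps_comp big_ord_recr /= fps_exp_X eqxx mulr1 big1 ?add0r //.
by move=> i _; rewrite fps_exp_X gtn_eqF ?mulr0.
Qed.

Lemma fps_X_comp u : u 0 = 0 -> fps_comp (fpsX K) u =1 u.
Proof.
move=> u0 [|n]; rewrite /fps_comp; first by rewrite big_ord1 /fpsX mul0r u0.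
rewrite big_ord_recl big_ord_recl /fpsX /= mul0r add0r mul1r.
rewrite big1 ?addr0; last by move=> i _; rewrite mul0r.
exact: fps_mul1.
Qed.

Lemma fps_comp_coef0 f u : fps_comp f u 0 = f 0.
Proof. by rewrite /fps_comp big_ord1 /fps_exp /= /fps1 mulr1. Qed.

Lemma fps_comp_mul f g u : u 0 = 0 ->
  fps_comp (fps_mul f g) u =1 fps_mul (fps_comp f u) (fps_comp g u).
Proof.
move=> u0 n; pose p h := fps_trunc n.+1 h.
(* Stated for any [q], since the product [p f * p g] may have degree above [n]. *)
have compE (q : {poly K}) i : (i <= n)%N ->
    (q \Po p u)`_i = \sum_(k < i.+1) q`_k * fps_exp u k i.
  move=> lein; rewrite comp_polyE coef_sum.
  under eq_bigr => k _ do rewrite coefZ -coef_fps_exp //.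
  (* Both sums are widened to a common bound. The extra terms vanish: for k above [i] because u^k
     starts in degree k, for k beyond [size q] because the coefficient of [q] is 0. *)
  rewrite (big_ord_widen (maxn (size q) i.+1) (fun k => q`_k * fps_exp u k i)
             (leq_maxl _ _)).
  rewrite (big_ord_widen (maxn (size q) i.+1) (fun k => q`_k * fps_exp u k i)
             (leq_maxr _ _)).
  rewrite big_mkcond [RHS]big_mkcond; apply: eq_bigr => k _ /=.
  case: ltnP => [_|leqk]; case: ltnP => // ltik.
    by rewrite fps_exp_lt ?mulr0.
  by rewrite nth_default ?mul0r.
have comp_coef h i : (i <= n)%N -> fps_comp h u i = (p h \Po p u)`_i.
  move=> lein; rewrite compE //; apply: eq_bigr => k _.
  by rewrite coef_fps_trunc // (leq_trans (ltn_ord k)).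
transitivity ((p f * p g) \Po p u)`_n.
  by rewrite compE //; apply: eq_bigr => k _; rewrite -coef_fps_mul.
rewrite comp_polyM coefM; apply: eq_bigr => i _.
by rewrite !comp_coef ?leq_subr // -ltnS.
Qed.

Lemma fps_inv_uniq f g h : f 0 != 0 ->
  fps_mul g f =1 h -> g =1 fps_mul h (fps_inv f).
Proof.
move=> f0 gf n; rewrite -(eq_fps_mul gf (fun=> erefl)) -fps_mulA.
by rewrite (eq_fps_mul (fun=> erefl) (fps_invP f0)) fps_mul1.
Qed.

(** The series log(1 + t) itself, free of composition; [fps_log1p] composes it with its argument. *)
Definition fps_log1p_coef : fps K :=
  fun k => if k is j.+1 then (-1) ^+ j / k%:R else 0.

Lemma fps_log1pE u : fps_log1p u = fps_comp fps_log1p_coef u.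
Proof. by []. Qed.

Lemma fps_log1p_1 u : u 0 = 0 -> fps_log1p u 1 = u 1.
Proof.
move=> u0; rewrite fps_log1pE /fps_comp big_ord_recl big_ord1 /=.
by rewrite mul0r add0r divr1 mul1r; apply: fps_mul1.
Qed.

Lemma degenerate_tE c n :
  degenerate_t c n = c^-1 * c ^+ n * fps_log1p_coef n.
Proof.
rewrite /degenerate_t /fps_scale fps_log1pE -mulrA; congr (_ * _).
rewrite /fps_comp big_ord_recr /=.
(* Powers of c t are monomials, so only the last term k = n of the composition survives. *)
have expE k : fps_exp (fun i => c * fpsX K i) k n = c ^+ k * (n == k)%:R.
  rewrite -fps_exp_X -[RHS]mul1r -(expr1n _ n) mulrCA mulrA -fps_exp_dilate.
  by apply: eq_fps_exp => i; rewrite expr1n mulr1.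
rewrite expE eqxx mulr1 mulrC big1 ?add0r // => i _.
by rewrite expE gtn_eqF ?mulr0.
Qed.

Lemma degenerate_t0 c : degenerate_t c 0 = 0.
Proof. by rewrite degenerate_tE mulr0. Qed.

Lemma degenerate_tS c n : c != 0 ->
  degenerate_t c n.+1 = (-1) ^+ n * c ^+ n / n.+1%:R.
Proof.
move=> c0; rewrite degenerate_tE /= exprS mulKf //.
by rewrite mulrA [c ^+ n * _]mulrC.
Qed.

(* The series [fun n => u n.+1] is u / t. *)
Lemma fps_X_div_log_comp u : u 0 = 0 -> u 1 != 0 ->
  fps_comp (fps_X_div (fps_log1p (fpsX K))) u
    =1 fps_mul (fun n => u n.+1) (fps_X_div (fps_log1p u)).
Proof.
move=> u0 u1; apply: fps_inv_uniq => [|n]; first by rewrite fps_log1p_1.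
have lu0 : fps_log1p u 0 = 0 by rewrite fps_log1pE fps_comp_coef0.
(* After multiplication by t, the goal is log(1 + u) Q(u) = u with Q = t / log(1 + t): this is log(1
   + t) Q = t composed with u. *)
rewrite fps_mulC -fps_mulS // -[u n.+1](fps_X_comp u0).
rewrite fps_log1pE -fps_comp_mul //; apply: eq_fps_comp => // i.
have lX0 : fps_log1p (fpsX K) 0 = 0 by rewrite fps_log1pE fps_comp_coef0.
rewrite -(fps_X_divP lX0) ?fps_log1p_1 ?oner_neq0 //.
by apply: eq_fps_mul => // k; rewrite fps_log1pE fps_comp_X.
Qed.

End FormalPowerSeriesTheory.

Lemma stirling1_0 l : stirling1 0 l = (l == 0)%:R.
Proof. by rewrite /stirling1 /ffactr big_ord0 coef1. Qed.

(** Compare coefficients in (x)_(n+1) = (x)_n (x - n). *)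
Lemma stirling1_S n l :
  stirling1 n.+1 l = (if l is j.+1 then stirling1 n j else 0)
                     - stirling1 n l *+ n.
Proof.
rewrite /stirling1 /ffactr big_ord_recr /= mulrBr mulr_natr coefB coefMX coefMn.
by case: l.
Qed.

Section Stirling.
Variable K : numFieldType.

(* The coefficient of t^n in (1 + t) (L^(k+1))' = (k + 1) L^k, L = log(1 + t). *)
Lemma fps_exp_log_rec k n :
  let L := fps_log1p_coef K in
  fps_exp L k.+1 n.+1 *+ n.+1 + fps_exp L k.+1 n *+ n = fps_exp L k n *+ k.+1.
Proof.
(* Cutting at [n.+2] keeps the coefficient of degree n + 1, which the derivative moves to degree
   n. *)
move=> L; pose p := fps_trunc n.+2 L.
have dE (q : {poly K}) i : ((1 + 'X) * q^`())`_i = q`_i.+1 *+ i.+1 + q`_i *+ i.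
  rewrite mulrDl mul1r coefD coefXM !coef_deriv.
  by case: i => [|i] //=; rewrite coef_deriv.
rewrite !(@coef_fps_exp _ n.+2) // -/p -dE deriv_exp /= -mulrnAr mulrA coefM.
(* As (1 + t) L' = 1, only the constant term of (1 + t) p' contributes: its coefficients in degrees
   1 to n cancel. *)
rewrite big_ord_recl big1 => [|i _].
  rewrite dE !coef_fps_trunc //= subn0 divr1 expr0 mulr1n mulr0n !addr0 mul1r.
  by rewrite coefMn.
rewrite dE !coef_fps_trunc ?ltnS //=; last exact: ltnW.
have divMn (a : K) j : a / j.+1%:R *+ j.+1 = a.
  by rewrite -mulr_natr divfK // Num.Theory.pnatr_eq0.
by rewrite !divMn exprS mulN1r addNr mul0r.
Qed.

(** Both sides satisfy a(n+1, k+1) = (k+1) a(n, k) - n a(n, k+1), by [fps_exp_log_rec] on the left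
    and [stirling1_S] on the right. *)
Lemma fps_exp_log_stirling1 n k :
  n`!%:R * fps_exp (fps_log1p_coef K) k n = k`!%:R * (stirling1 n k)%:~R.
Proof.
elim: n k => [|n IH] k.
  rewrite stirling1_0; case: k => [|k]; first by rewrite /fps_exp /fps1.
  by rewrite fps_exp_lt // !mulr0.
rewrite stirling1_S; case: k => [|k].
  (* For k = 0 the left side is 0, as the series 1 has no term of positive degree. The right side
     reduces to -n S_1(n, 0), which is 0 by the factor n or by the induction hypothesis. *)
  have := IH 0; rewrite fact0 !mul1r sub0r rmorphN rmorphMn /= => <-.
  rewrite /fps_exp /fps1 /= mulr0.
  by case: n {IH} => [|n]; rewrite ?mulr0n ?mulr0 ?mul0rn oppr0.
have /(canRL (addrK _)) E := fps_exp_log_rec k n.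
rewrite factS natrM -mulrA mulrCA [n.+1%:R * _]mulr_natl E.
rewrite rmorphB rmorphMn /= !mulrBr !mulrnAr !IH.
by rewrite -[_ *+ k.+1]mulr_natl mulrA -natrM -factS -IH.
Qed.

End Stirling.

Theorem theorem2p2 (R : realType) (lambda x : complex R) (n : nat) :
  lambda != 0 ->
  \sum_(0 <= m < n.+1)
     cauchy_poly m x * lambda ^+ (n - m) * (stirling1 n m)%:~R
  = \sum_(0 <= m < n.+1)
     (n - m)`!%:R / (n - m + 1)%:R * 'C(n, m)%:R * (-1) ^+ (n - m)
       * lambda ^+ (n - m) * degenerate_cauchy2 m lambda x.
Proof.
move=> c0; set u := degenerate_t lambda.
have u0 : u 0 = 0 := degenerate_t0 lambda.
have u1 : u 1 != 0 by rewrite /u degenerate_tS // expr0 mul1r divr1 oner_neq0.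
pose Q := fps_X_div (fps_log1p (fpsX (complex R))).
pose E := fps_pow1p (fpsX (complex R)) x.
pose D := fps_mul (fps_X_div (fps_log1p u)) (fps_pow1p u x).
transitivity (n`!%:R * fps_comp (fps_mul Q E) u n).
  rewrite big_mkord mulr_sumr; apply: eq_bigr => k _.
  (* [u] is log(1 + t) dilated by the factors 1/lambda and lambda, so the coefficient of t^n in u^k
     gains lambda^(n-k). *)
  rewrite (eq_fps_exp _ (degenerate_tE lambda)) fps_exp_dilate /cauchy_poly.
  have -> : lambda ^+ n = lambda ^+ k * lambda ^+ (n - k).
    by rewrite -exprD subnKC // -ltnS.
  rewrite exprVn mulKf ?expf_neq0 //.
  rewrite [RHS]mulrCA [n`!%:R * _]mulrCA fps_exp_log_stirling1.
  by rewrite -/Q -/E; ring.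
transitivity (n`!%:R * fps_mul (fun i => u i.+1) D n).
  congr (_ * _); rewrite fps_comp_mul // /D fps_mulA.
  apply: eq_fps_mul => i; first exact: fps_X_div_log_comp.
  by apply: eq_fps_comp => // j; apply: fps_comp_X.
rewrite fps_mulC big_mkord mulr_sumr; apply: eq_bigr => m _.
rewrite /u degenerate_tS // -/u /degenerate_cauchy2 -/u -/D.
have lemn : (m <= n)%N by rewrite -ltnS.
(* n! splits as C(n, m) m! (n-m)!: the m! belongs to C_{m,lambda}(x), and (n-m)! stays over the
   n-m+1 from the coefficient of u / t. *)
rewrite -(bin_fact lemn) !natrM addn1.
by ring.
Qed.
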